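(* Let $d\ge 2$ be an integer. Let $H$ be a connected graph with maximum degree $d$ and $N$ vertices, where $N>d^{d^{d^d}}$. Then there exists a graph $G$ such that $N\le |V(G)|\le 2^{d^{21d+20}}N$, the maximum degree of $G$ is at most $d\,2^{d^{21d+20}}$, and there are at least $2^{|V(G)|/2^{d^{21d+20}}}$ sets $S\subseteq V(G)$ such that $G[S]$ is a maximal blow-up of $H$.
   Context: All graphs are finite and simple. With $V(H)=\{1,\dots,k\}$, a blow-up of $H$ is a graph whose vertex set is partitioned into nonempty sets $V_1\sqcup\dots\sqcup V_k$ such that $V_i$ is complete to $V_j$ whenever $ij\in E(H)$ (no other conditions; edges inside parts and between parts of non-adjacent vertices are allowed). For $S\subseteq V(G)$, $G[S]$ is a maximal blow-up of $H$ if $G[S]$ is a blow-up of $H$ and there is no $S'$ with $S\subsetneq S'\subseteq V(G)$ such that $G[S']$ is a blow-up of $H$. *)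

(* Defs.v *)
From mathcomp Require Import all_boot.
Set Implicit Arguments.
Unset Strict Implicit.
Unset Printing Implicit Defensive.

Record sgraph := SGraph {
  vertex :> finType;
  edge : rel vertex;
  edge_sym : symmetric edge;
  edge_irr : irreflexive edge }.

Arguments edge {s} : rename.

Definition neighbors (G : sgraph) (x : G) : {set G} := [set y | edge x y].

Definition max_degree (G : sgraph) : nat := \max_(x : G) #|neighbors x|.

Definition connected_graph (G : sgraph) : bool :=
  (0 < #|G|) && [forall x : G, forall y : G, connect edge x y].

Section Induced.
Variables (G : sgraph) (S : {set G}).

Definition induced_edge : rel {x : G | x \in S} :=
  fun x y => edge (val x) (val y).

Lemma induced_edge_sym : symmetric induced_edge.
Proof. by move=> x y; exact: edge_sym. Qed.

Lemma induced_edge_irr : irreflexive induced_edge.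
Proof. by move=> x; exact: edge_irr. Qed.

Definition induced : sgraph := SGraph induced_edge_sym induced_edge_irr.
End Induced.

(* [P i] is the part of [G] associated with the vertex [i] of [H]. The parts
   are indexed by [H] itself, so no ordering of the vertices is involved. *)
Definition blowup_parts (H G : sgraph) (P : H -> {set G}) : bool :=
  [&& [forall i, P i != set0],
      [forall i, forall j, (i != j) ==> [disjoint P i & P j]],
      \bigcup_i P i == [set: G] &
      [forall i, forall j, edge i j ==>
         [forall x in P i, forall y in P j, edge x y]]].

Definition is_blowup (H G : sgraph) : bool :=
  [exists P : {ffun H -> {set G}}, blowup_parts P].

Definition maximal_blowup (H G : sgraph) (S : {set G}) : bool :=
  is_blowup H (induced S) &&
  ~~ [exists S' : {set G}, (S \proper S') && is_blowup H (induced S')].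

Definition maximal_blowups (H G : sgraph) : {set {set G}} :=
  [set S : {set G} | maximal_blowup H S].

(* Main.v *)
(* Let C be a set of vertices of H with pairwise disjoint closed neighbourhoods,
   and let G have vertex set H x [q], where (x, i) and (y, j) are adjacent when
   x and y are and, if x or y is in C, i = j. Choosing a layer for each closed
   neighbourhood of C gives q^|C| copies of H in G. On the other hand, vertices
   of G over C have pairwise disjoint neighbourhoods, and in a blow-up of H every
   vertex is adjacent to one of N fixed representatives of the parts; so a
   blow-up contains at most N vertices over C, hence by AM-GM at most (N/|C|)^|C|
   of the copies. Since N/|C| <= (d+1)^2 for a maximal C, taking q = 2(d+1)^2
   leaves at least 2^|C| maximal blow-ups. *)
Require Import Defs.
From mathcomp Require Import all_boot all_order all_algebra.
From mathcomp Require Import reals exp.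
From mathcomp Require Import zify.
Set Implicit Arguments.
Unset Strict Implicit.
Unset Printing Implicit Defensive.
Import Order.TTheory GRing.Theory Num.Theory.

(** * Closed neighbourhoods and packings *)

Lemma connected_neighbor (H : sgraph) (x : H) :
  connected_graph H -> 1 < #|H| -> exists y, edge x y.
Proof.
case/andP=> _ /forallP/(_ x)/forallP conn gt1.
have /card_gt0P[y] : 0 < #|[set~ x]| by rewrite cardsC1 -ltnS prednK // ltnW.
rewrite !inE => neq_yx.
have /connectP[[|z p] /= pth eq_y] := conn y; first by rewrite eq_y eqxx in neq_yx.
by exists z; case/andP: pth.
Qed.

Definition closed_nbhd (H : sgraph) (x : H) : {set H} := x |: neighbors x.

Lemma closed_nbhd_refl (H : sgraph) (x : H) : x \in closed_nbhd x.
Proof. exact: setU11. Qed.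

Lemma closed_nbhd_edge (H : sgraph) (x y : H) : edge x y -> y \in closed_nbhd x.
Proof. by move=> exy; rewrite !inE exy orbT. Qed.

Lemma closed_nbhd_sym (H : sgraph) (x y : H) :
  (y \in closed_nbhd x) = (x \in closed_nbhd y).
Proof. by rewrite !inE eq_sym edge_sym. Qed.

Lemma card_neighbors (H : sgraph) (x : H) : #|neighbors x| <= max_degree H.
Proof. exact: (leq_bigmax (F := fun x : H => #|neighbors x|)). Qed.

Lemma card_closed_nbhd (H : sgraph) (x : H) :
  #|closed_nbhd x| <= (max_degree H).+1.
Proof.
by rewrite cardsU1 -add1n leq_add ?leq_b1 ?card_neighbors.
Qed.

Definition packing (H : sgraph) (C : {set H}) : bool :=
  [forall x in C, forall y in C,
     (x != y) ==> [disjoint closed_nbhd x & closed_nbhd y]].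

Lemma packingP (H : sgraph) (C : {set H}) (x y z : H) : packing C ->
  x \in C -> y \in C -> z \in closed_nbhd x -> z \in closed_nbhd y -> x = y.
Proof.
move=> /forall_inP pC xC yC zx zy; apply/eqP; apply: contraT => neq.
have /forall_inP/(_ y yC)/implyP/(_ neq)/pred0P/(_ z)/= := pC x xC.
by rewrite zx zy.
Qed.

Lemma leq_card_bigcup (I T : finType) (A : {set I}) (F : I -> {set T}) (k : nat) :
  (forall i, i \in A -> #|F i| <= k) -> #|\bigcup_(i in A) F i| <= #|A| * k.
Proof.
move=> leFk; rewrite -sum_nat_const.
elim/big_rec2: _ => [|i s B iA le_Bs]; first by rewrite cards0.
by rewrite (leq_trans (leq_card_setU _ _).1) ?leq_add ?leFk.
Qed.

(* A maximal packing works: its balls of radius 2 cover the graph. *)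
Lemma large_packing (H : sgraph) :
  exists2 C : {set H}, packing C & #|H| <= #|C| * ((max_degree H).+1 * (max_degree H).+1).
Proof.
have p0 : packing (set0 : {set H}).
  by apply/forall_inP=> x; rewrite inE.
have [C /maxsetP[pC maxC] _] := maxset_exists p0; exists C => //.
have cover : [set: H] \subset
    \bigcup_(c in C) \bigcup_(z in closed_nbhd c) closed_nbhd z.
  apply/subsetP=> y _; apply: contraT => /bigcupP ny.
  have djy c : c \in C -> [disjoint closed_nbhd y & closed_nbhd c].
    move=> cC; rewrite -setI_eq0; apply/set0Pn => -[z /setIP[zy zc]].
    by apply: ny; exists c => //; apply/bigcupP; exists z; rewrite // closed_nbhd_sym.
  have packyC : packing (y |: C).
    apply/forall_inP=> a /setU1P aC; apply/forall_inP=> b /setU1P bC.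
    apply/implyP; case: aC bC => [->|aC] [->|bC] neq_ab.
    - by rewrite eqxx in neq_ab.
    - exact: djy.
    - by rewrite disjoint_sym djy.
    - by move/forall_inP/(_ a aC)/forall_inP/(_ b bC)/implyP: pC; apply.
  case: ny; exists y; first by rewrite -(maxC _ packyC (subsetUr _ _)) setU11.
  by apply/bigcupP; exists y; exact: closed_nbhd_refl.
rewrite -cardsT (leq_trans (subset_leq_card cover)) // leq_card_bigcup // => c _.
apply: leq_trans (leq_card_bigcup _) (leq_mul (card_closed_nbhd c) (leqnn _)) => z _.
exact: card_closed_nbhd.
Qed.

(** * The layered graph and the copies of [H] inside it *)

Section Layered.
Variables (H : sgraph) (C : {set H}) (q : nat).

Definition layered_edge : rel (H * 'I_q) := fun u v =>
  edge u.1 v.1 && ((u.1 \in C) || (v.1 \in C) ==> (u.2 == v.2)).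

Lemma layered_edge_sym : symmetric layered_edge.
Proof. by move=> u v; rewrite /layered_edge edge_sym orbC eq_sym. Qed.

Lemma layered_edge_irr : irreflexive layered_edge.
Proof. by move=> u; rewrite /layered_edge edge_irr. Qed.

Definition layered : sgraph := SGraph layered_edge_sym layered_edge_irr.

Lemma card_layered : #|layered| = #|H| * q.
Proof. by rewrite card_prod card_ord. Qed.

Lemma max_degree_layered : max_degree layered <= max_degree H * q.
Proof.
apply/bigmax_leqP => u _.
have sub : neighbors u \subset setX (neighbors u.1) [set: 'I_q].
  by apply/subsetP=> v; rewrite !inE => /andP[-> _].
by rewrite (leq_trans (subset_leq_card sub)) // cardsX cardsT card_ord
  leq_mul2r card_neighbors orbT.
Qed.

(** The default [x] makes a vertex outside all closed neighbourhoods of [C] its own center, so its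
    layer is chosen independently. *)
Definition center (x : H) : H :=
  odflt x [pick c in C | x \in closed_nbhd c].

(** Only the values of [e] at centers matter. Taking [e] on all of [H] repeats copies, but the later
    count is over the functions [e], and the surplus factor cancels. *)
Definition layered_copy (e : {ffun H -> 'I_q}) : {set layered} :=
  [set (x, e (center x)) | x : H].

Hypothesis packC : packing C.

Lemma center_nbhd (c x : H) : c \in C -> x \in closed_nbhd c -> center x = c.
Proof.
move=> cC xc; rewrite /center; case: pickP => [c' /andP[c'C xc']|/(_ c)] /=.
  exact: packingP packC c'C cC xc' xc.
by rewrite cC xc.
Qed.

(** The parts are the fibres over [H]. An edge with an end [c] in [C] lies inside the closed
    neighbourhood of [c], where [center] is constant, so its ends share a layer; other edges put no
    condition on layers. *)
Lemma layered_copy_blowup (e : {ffun H -> 'I_q}) :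
  is_blowup H (induced (layered_copy e)).
Proof.
pose P := [ffun x : H => [set u : induced (layered_copy e) | (val u).1 == x]].
apply/existsP; exists P; apply/and4P; split.
- apply/forallP=> x; apply/set0Pn.
  have xS : (x, e (center x)) \in layered_copy e by exact: imset_f.
  by exists (exist (fun u => u \in layered_copy e) _ xS); rewrite ffunE inE.
- apply/forallP=> x; apply/forallP=> y; apply/implyP=> neq_xy.
  rewrite -setI_eq0; apply/set0Pn => -[u]; rewrite !ffunE !inE => /andP[/eqP-> /eqP eq_xy].
  by rewrite eq_xy eqxx in neq_xy.
- apply/eqP/setP=> u; rewrite inE; apply/bigcupP.
  by exists (val u).1; rewrite // ffunE inE.
- apply/forallP=> x; apply/forallP=> y; apply/implyP=> exy.
  apply/forall_inP=> -[u uS]; rewrite !ffunE inE /= => /eqP eq_ux.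
  apply/forall_inP=> -[v vS]; rewrite inE /= => /eqP eq_vy.
  rewrite /= /induced_edge /=.
  have /imsetP[x' _ def_u] := uS; have /imsetP[y' _ def_v] := vS.
  move: eq_ux eq_vy exy; rewrite def_u def_v /layered_edge /= => -> -> exy.
  rewrite exy /=.
  apply/implyP=> /orP[xC | yC]; apply/eqP; congr (e _).
    by rewrite !(center_nbhd xC) ?closed_nbhd_refl ?closed_nbhd_edge.
  by rewrite !(center_nbhd yC) ?closed_nbhd_refl ?closed_nbhd_edge // edge_sym.
Qed.

(* A vertex [u] over [C] lies in a part with a neighbouring part [P h]; every
   representative of [P h] is adjacent to [u], and to no other vertex over [C]. *)
Lemma card_blowup_over_packing (S : {set layered}) :
  (forall h : H, exists h', edge h h') ->
  is_blowup H (induced S) -> #|[set u in S | u.1 \in C]| <= #|H|.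
Proof.
move=> nbr /existsP[P /and4P[/forallP P0 _ /eqP covP /forallP adjP]].
have /fin_all_exists[t tP] : forall h, exists u, u \in P h.
  by move=> h; apply/set0Pn.
have sub : [set u in S | u.1 \in C] \subset
    \bigcup_(h in [set: H]) [set u : layered | (u.1 \in C) && edge u (val (t h))].
  apply/subsetP=> u; rewrite inE => /andP[uS uC].
  have : exist (fun u => u \in S) u uS \in [set: induced S] by rewrite inE.
  rewrite -covP => /bigcupP[h _ uh]; have [h' hh'] := nbr h.
  apply/bigcupP; exists h'; rewrite // inE uC /=.
  have /forallP/(_ h')/implyP/(_ hh')/forall_inP/(_ _ uh)/forall_inP := adjP h.
  by move/(_ _ (tP h')).
rewrite (leq_trans (subset_leq_card sub)) //.
rewrite -[#|H|]muln1 -[in leqRHS]cardsT leq_card_bigcup // => h _.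
(* Adjacency to [(z, j)] from above [C] forces layer [j], and the packing leaves one choice in
   [C]. *)
case: (val (t h)) => z j; apply/card_le1_eqP => -[c i] [c' i'].
rewrite !inE /= => /andP[cC /andP[/= ecz]] ; rewrite cC /= => /eqP ->.
move=> /andP[c'C /andP[/= ec'z]]; rewrite c'C /= => /eqP ->.
by rewrite (packingP packC cC c'C (closed_nbhd_edge ecz) (closed_nbhd_edge ec'z)).
Qed.

End Layered.

(** * Counting copies inside blow-ups *)

Lemma AGM_nat (I : finType) (A : {set I}) (a : I -> nat) :
  \prod_(i in A) a i * #|A| ^ #|A| <= (\sum_(i in A) a i) ^ #|A|.
Proof.
have := @leif_AGM_scaled int I A (fun i => (a i)%:R%R).
rewrite -prod_nat_const -big_split /=.
case=> [i _|le_AGM _]; first by rewrite mulrn_wge0 ?ler0n.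
rewrite -(ler_nat int) natrX natr_sum natr_prod.
by under eq_bigr do rewrite natrM mulr_natr.
Qed.

(** A copy inside [S] requires [(c, e c)] in [S] for each [c] in [C]; the other values of [e] are
    left free. The numbers of choices at the points of [C] sum to at most [#|C| * b], so AM-GM
    bounds their product. *)
Lemma card_layered_copies (H : sgraph) (C : {set H}) (q b : nat)
    (S : {set layered C q}) :
  packing C -> (forall h : H, exists h', edge h h') ->
  #|H| <= #|C| * b -> is_blowup H (induced S) ->
  #|[set e | layered_copy C e \subset S]| <= b ^ #|C| * q ^ (#|H| - #|C|).
Proof.
move=> packC nbr leHCb blS.
pose F (x : H) := [pred i : 'I_q | (x \in C) ==> ((x, i) \in S)].
have sub : [set e | layered_copy C e \subset S] \subset
    [set e : {ffun H -> 'I_q} | e \in family F].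
  apply/subsetP=> e; rewrite !inE => /subsetP eS.
  apply/forallP=> x; rewrite inE; apply/implyP=> xC; apply: eS.
  apply/imsetP; exists x => //.
  by rewrite (center_nbhd packC xC) ?closed_nbhd_refl.
apply: leq_trans (subset_leq_card sub) _.
rewrite cardsE card_family foldrE big_map big_enum /= (bigID (mem C)) /=.
apply: leq_mul; last first.
  have -> : #|H| - #|C| = #|~: C| by rewrite [RHS]cardsCs setCK.
  rewrite -prod_nat_const [leqRHS](eq_bigl (fun x => x \notin C)); last first.
    by move=> x; rewrite inE.
  by apply: leq_prod => x _; rewrite (leq_trans (max_card _)) ?card_ord.
(* This factor is positive even for empty [C], where it is [0 ^ 0 = 1]. *)
rewrite -(@leq_pmul2r (#|C| ^ #|C|)); last by rewrite expn_gt0; case: #|C|.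
apply: leq_trans (AGM_nat _ _) _; rewrite -expnMn [b * _]mulnC.
have [->|C_gt0] := posnP #|C|; first by rewrite !expn0.
rewrite leq_exp2r //.
apply: leq_trans leHCb; apply: leq_trans (card_blowup_over_packing packC nbr blS).
(* Summed over [C], the choices count the vertices of [S] above [C]. *)
rewrite (eq_bigr (fun x => \sum_(i | F x i) 1)) => [|x _]; last first.
  by rewrite -sum1_card.
rewrite pair_big_dep /= -sum1_card leq_eqVlt.
apply/orP; left; apply/eqP; apply: eq_bigl => -[x i]; rewrite !inE /=.
by case: (x \in C); rewrite /= ?andbT ?andbF.
Qed.

(** Each copy extends to a maximal blow-up, so these cover all [q ^ #|H|] functions [e]; dividing by
    the bound per blow-up leaves [(q / b) ^ #|C|], with [q = 2 * b]. *)
Lemma many_maximal_blowups (H : sgraph) (C : {set H}) (b : nat) :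
  packing C -> (forall h : H, exists h', edge h h') ->
  0 < b -> #|H| <= #|C| * b ->
  2 ^ #|C| <= #|maximal_blowups H (layered C (2 * b))|.
Proof.
move=> packC nbr b_gt0 leHCb; set q := 2 * b; set M := maximal_blowups _ _.
have cover : [set: {ffun H -> 'I_q}] \subset
    \bigcup_(S in M) [set e | layered_copy C e \subset S].
  apply/subsetP=> e _.
  have [S /maxsetP[blS maxS] eS] := maxset_exists (P := fun S => is_blowup H (induced S))
    (layered_copy_blowup packC e).
  apply/bigcupP; exists S; rewrite inE // /maximal_blowup blS /=.
  apply/existsP => -[S' /andP[/properP[SS' [u uS' /negP uNS]] blS']]; apply: uNS.
  by rewrite -(maxS _ blS' SS').
have := subset_leq_card cover.
rewrite cardsT card_ffun card_ord => le_qH.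
have {}le_qH : q ^ #|H| <= #|M| * (b ^ #|C| * q ^ (#|H| - #|C|)).
  apply: leq_trans le_qH (leq_card_bigcup _) => S.
  by rewrite inE => /andP[blS _]; exact: card_layered_copies.
move: le_qH; rewrite -{1}(subnKC (max_card (mem C))) expnD mulnA.
rewrite leq_pmul2r ?expn_gt0 ?muln_gt0 ?b_gt0 // /q expnMn.
by rewrite leq_pmul2r // expn_gt0 b_gt0.
Qed.

(** * Numerical bound and conclusion *)

Lemma packing_constant_bound (d : nat) : 2 <= d ->
  2 * (d.+1 * d.+1) * (d.+1 * d.+1) <= 2 ^ (d ^ (21 * d + 20)).
Proof.
move=> d_ge2; have leS : d.+1 <= 2 ^ d by exact: ltn_expl.
have le2 : d.+1 * d.+1 <= 2 ^ d * 2 ^ d by exact: leq_mul.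
apply: leq_trans (_ : 2 * (2 ^ d * 2 ^ d) * (2 ^ d * 2 ^ d) <= _).
  by rewrite leq_mul ?leq_mul.
(* The exponents compare through [4 * d + 1 <= 8 * d <= d ^ 4]. *)
rewrite -!expnD -expnS -expnD leq_exp2l //.
apply: leq_trans (_ : d ^ 4 <= _); last by rewrite leq_exp2l // addnC ltn_addr.
apply: leq_trans (_ : d * 8 <= _).
  by rewrite addSn -addnA; lia.
by rewrite expnS leq_mul2l (@leq_exp2r 2 d 3) ?d_ge2 ?orbT.
Qed.

Local Open Scope ring_scope.

Theorem theorem6 (R : realType) (d N : nat) (H : sgraph) :
  (2 <= d)%N ->
  connected_graph H ->
  max_degree H = d ->
  #|H| = N ->
  (d ^ (d ^ (d ^ d)) < N)%N ->
  exists G : sgraph,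
    [/\ (N <= #|G| <= 2 ^ (d ^ (21 * d + 20)) * N)%N,
        (max_degree G <= d * 2 ^ (d ^ (21 * d + 20)))%N &
        2 `^ (#|G|%:R / 2 ^+ (d ^ (21 * d + 20))%N) <=
          #|maximal_blowups H G|%:R :> R].
Proof.
move=> d_ge2 connH degH cardH ltN.
have N_gt1 : (1 < #|H|)%N.
  by rewrite cardH (leq_trans _ ltN) // ltnS expn_gt0 (ltnW d_ge2).
(* No vertex of [H] is isolated, so each part of a blow-up has a neighbouring part. *)
have nbr (h : H) := connected_neighbor h connH N_gt1.
have [C packC leHC] := large_packing H; rewrite degH in leHC.
have leK := packing_constant_bound d_ge2.
set b := (d.+1 * d.+1)%N in leHC leK *; set K := (2 ^ _)%N in leK *.
have b_gt0 : (0 < b)%N by [].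
have leqK : (2 * b <= K)%N by apply: leq_trans leK; rewrite leq_pmulr.
exists (layered C (2 * b)); split.
- by rewrite card_layered cardH leq_pmulr // mulnC leq_mul2r leqK orbT.
- by rewrite (leq_trans (max_degree_layered _ _)) // degH leq_mul2l leqK orbT.
have := many_maximal_blowups packC nbr b_gt0 leHC.
rewrite -(ler_nat R) natrX; apply: le_trans.
rewrite -[leRHS]powR_mulrn // ler_powR ?ler1n // ler_pdivrMr ?exprn_gt0 //.
rewrite card_layered -natrX -natrM ler_nat.
(* One factor [b] comes from [#|H| <= #|C| * b], the factor [2 * b] from the layers; hence the
   requirement [2 * b * b <= K]. *)
apply: leq_trans (_ : #|C| * b * (2 * b) <= _)%N; first by rewrite leq_mul2r leHC orbT.
by rewrite -mulnA leq_mul2l [(b * _)%N]mulnC leK orbT.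
Qed.
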